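(* Let $\mathcal{A}$ be a finite abelian group, $\mathbb{M}$ a countable monoid, $\mathfrak{F}:\mathcal{A}^{\mathbb{M}}\to\mathcal{A}^{\mathbb{M}}$ a linear cellular automaton, and $\mu$ a harmonically mixing probability measure on $\mathcal{A}^{\mathbb{M}}$. (1) If $\mathfrak{F}$ is diffusive, then $\mathfrak{F}^j\mu\to\eta$ in the weak* topology as $j\to\infty$. (2) If $\mathfrak{F}$ is diffusive in density, then there is a set $J\subset\mathbb{N}$ of Cesàro density $1$ such that $\mathfrak{F}^j\mu\to\eta$ weak* as $j\to\infty$, $j\in J$; consequently $\frac1N\sum_{n=1}^N\mathfrak{F}^n\mu\to\eta$ weak*.
   Context: $\eta$ denotes the Haar measure on the compact group $\mathcal{A}^{\mathbb{M}}$ (product of uniform measures). $\mathfrak{F}^j\mu=\mu\circ\mathfrak{F}^{-j}$. An LCA is a continuous group endomorphism commuting with all shifts $\sigma^e$, $(\sigma^e\mathbf{a})_m=a_{e.m}$. Characters of $\mathcal{A}^{\mathbb{M}}$ are $\chi=\bigotimes_m\chi_m$, $\chi_m$ characters of $\mathcal{A}$, all but finitely many trivial; rank$(\chi)$ is the number of nontrivial $\chi_m$. $\mu$ is harmonically mixing if for every $\varepsilon>0$ there is $R$ with rank$(\chi)>R\Rightarrow|\int\chi\,d\mu|<\varepsilon$. $\mathfrak{F}$ is diffusive if for every nontrivial character $\chi$, rank$(\chi\circ\mathfrak{F}^n)\to\infty$ as $n\to\infty$; it is diffusive in density if for every nontrivial character $\chi$ there is $J_\chi\subset\mathbb{N}$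 of Cesàro density 1 (i.e. $|J_\chi\cap[1,N]|/N\to1$) with rank$(\chi\circ\mathfrak{F}^j)\to\infty$ as $j\to\infty$, $j\in J_\chi$. *)

(* Defs.v *)
From HB Require Import structures.
From mathcomp Require Import all_boot all_order all_algebra.
From mathcomp Require Import all_classical all_reals all_analysis.
From mathcomp Require Import complex.

Set Implicit Arguments.
Unset Strict Implicit.
Unset Printing Implicit Defensive.

Import Order.TTheory GRing.Theory Num.Theory.
Import numFieldNormedType.Exports.
Local Open Scope classical_set_scope.
Local Open Scope ring_scope.

Definition conf (A : finZmodType) (M : Type) := M -> A.

HB.instance Definition _ (A : finZmodType) (M : Type) := Choice.on (conf A M).
HB.instance Definition _ (A : finZmodType) (M : Type) :=
  isPointed.Build (conf A M) (fun _ => 0).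

(** Elementary cylinder sets {x | x_m = a}; they generate the product
    (= Borel, since M is countable and A is finite discrete) sigma-algebra. *)
Definition cyl (A : finZmodType) (M : Type) : set (set (conf A M)) :=
  [set B | exists m a, B = [set x : conf A M | x m = a]].
Arguments cyl : clear implicits.

Notation cfg A M := (g_sigma_algebraType (cyl A M)).

Section Defs.
Variables (R : realType) (A : finZmodType) (M : countType).
Implicit Types (x y : conf A M).

Definition caddf x y : conf A M := fun m => x m + y m.

Definition shift (mul : M -> M -> M) (e : M) x : conf A M := fun m => x (mul e m).

(** continuity of F : A^M -> A^M for the product topology (A discrete) *)
Definition cont_map (F : conf A M -> conf A M) :=
  forall x m, exists S : seq M,
    forall y, (forall k, k \in S -> y k = x k) -> F y m = F x m.

(** continuity of f : A^M -> R for the product topology (A discrete) *)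
Definition cont_fun (f : conf A M -> R) :=
  forall x (e : R), 0 < e -> exists S : seq M,
    forall y, (forall k, k \in S -> y k = x k) -> `|f y - f x| < e.

Definition is_LCA (mul : M -> M -> M) (F : conf A M -> conf A M) :=
  [/\ cont_map F,
      (forall x y, F (caddf x y) = caddf (F x) (F y)) &
      (forall e x, F (shift mul e x) = shift mul e (F x))].

Definition is_charA (c : A -> R[i]) :=
  (forall a, `|c a| = 1) /\ (forall a b, c (a + b) = c a * c b).

(** characters of A^M: chi = tensor_m chi_m, chi_m characters of A, all
    trivial outside the finite list ch_supp *)
Record character := Character {
  ch_supp : seq M;
  ch_comp : M -> A -> R[i];
  ch_compP : forall m, is_charA (ch_comp m);
  ch_suppP : forall m, m \notin ch_supp -> forall a, ch_comp m a = 1 }.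

Definition ch_eval (chi : character) x : R[i] :=
  \prod_(m <- undup (ch_supp chi)) ch_comp chi m (x m).

Definition ch_rank (chi : character) : nat :=
  count (fun m => [exists a, ch_comp chi m a != 1]) (undup (ch_supp chi)).

Definition ch_nontrivial (chi : character) := exists x, ch_eval chi x != 1.

Definition rank_gt (g : conf A M -> R[i]) (r : nat) :=
  exists psi : character, (forall x, ch_eval psi x = g x) /\ (r < ch_rank psi)%N.

Definition cintegral (nu : set (cfg A M) -> \bar R) (g : cfg A M -> R[i]) : R[i] :=
  Complex (fine (\int[nu]_x (complex.Re (g x))%:E)%E) (fine (\int[nu]_x (complex.Im (g x))%:E)%E).

Definition harmonically_mixing (mu : set (cfg A M) -> \bar R) :=
  forall eps : R, 0 < eps -> exists r : nat,
    forall chi : character, (r < ch_rank chi)%N ->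
      `|cintegral mu (ch_eval chi)| < Complex eps 0.

Definition diffusive (F : conf A M -> conf A M) :=
  forall chi : character, ch_nontrivial chi ->
    forall r : nat, exists N : nat, forall n, (N <= n)%N ->
      rank_gt (fun x => ch_eval chi (iter n F x)) r.

Definition density_one (J : pred nat) :=
  (fun N : nat => ((count J (iota 1 N))%:R / N%:R : R)) @ \oo --> (1 : R).

Definition diffusive_in_density (F : conf A M -> conf A M) :=
  forall chi : character, ch_nontrivial chi ->
    exists J : pred nat, density_one J /\
      forall r : nat, exists N : nat, forall n, (N <= n)%N -> J n ->
        rank_gt (fun x => ch_eval chi (iter n F x)) r.

(** Haar measure on A^M: product of uniform measures, i.e. every cylinder
    fixing the values on k distinct coordinates has measure |A|^-k *)
Definition is_haar (eta : set (cfg A M) -> \bar R) :=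
  forall (S : seq M) (b : conf A M), uniq S ->
    eta [set x : cfg A M | forall m, m \in S -> x m = b m]
    = ((#|A|%:R : R) ^- size S)%:E.

Definition pushF (mu : set (cfg A M) -> \bar R) (F : conf A M -> conf A M) (j : nat)
  : set (cfg A M) -> \bar R := pushforward mu (iter j F : cfg A M -> cfg A M).

Definition weakstar_cvg_along (J : pred nat) (nus : nat -> set (cfg A M) -> \bar R)
  (nu : set (cfg A M) -> \bar R) :=
  forall f : conf A M -> R, cont_fun f ->
    (fun j => \int[nus j]_x (f x)%:E)%E @ within [set j | J j] \oo
      --> (\int[nu]_x (f x)%:E)%E.

Definition weakstar_cvg (nus : nat -> set (cfg A M) -> \bar R) (nu : set (cfg A M) -> \bar R) :=
  weakstar_cvg_along predT nus nu.

Definition cesaro_avg (mu : set (cfg A M) -> \bar R) (F : conf A M -> conf A M) (N : nat)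
  : set (cfg A M) -> \bar R :=
  fun B => (((N%:R : R)^-1)%:E * \sum_(1 <= n < N.+1) pushF mu F n B)%E.

End Defs.

Arguments diffusive R {A M} F.
Arguments diffusive_in_density R {A M} F.
Arguments density_one R J.

(* Main.v *)
Require Import Defs.
From HB Require Import structures.
From mathcomp Require Import all_boot all_order all_algebra.
From mathcomp Require Import all_fingroup all_solvable all_field.
From mathcomp Require Import all_classical all_reals all_analysis.
From mathcomp Require Import measurable_realfun complex.
From mathcomp Require Import lra.
Import Order.TTheory GRing.Theory Num.Theory.
Import numFieldNormedType.Exports.
Local Open Scope classical_set_scope.
Local Open Scope ring_scope.

(** Convergence to Haar measure is tested on characters: on the compact space
    [A^M] continuous functions are uniform limits of functions of finitely many
    coordinates, and these are linear combinations of characters. Since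
    [chi o F^n] is again a character, harmonic mixing turns the growth of its
    rank into the decay of its integral, while [eta] annihilates every
    nontrivial character. In the density case each of the countably many
    cylinder sets comes with its own density-one set of times; a diagonal
    argument merges them into one, and bounded sequences converging along a
    density-one set converge in the Cesaro sense. *)

Set Implicit Arguments.
Unset Strict Implicit.
Unset Printing Implicit Defensive.

(** * Characters of a finite abelian group separate points *)

Lemma mulrn_card_eq0 (A : finZmodType) (a : A) : a *+ #|A| = 0.
Proof. by rewrite -FinRing.zmodXgE -cardsT (@expg_cardG _ [set: A]%G) ?inE. Qed.

(** The minimal polynomial of [B] divides ['X^k - 1], which splits with simple roots because [k] is
    nonzero in [F]. *)
Lemma diagonalizable_of_expr_eq1 (F : closedFieldType) (n k : nat)
    (B : 'M[F]_n.+1) : (k%:R : F) != 0 -> B ^+ k = 1 -> diagonalizable B.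
Proof.
move=> k0 Bk; apply/diagonalizableP.
have [rs rsE] := closed_field_poly_normal ('X^k - 1 : {poly F}).
have kgt0 : (0 < k)%N by case: k k0 {Bk rsE} => //; rewrite eqxx.
move: rsE; rewrite (lead_coefXnsubC 1 kgt0) scale1r => rsE.
exists rs; first by rewrite -separable_prod_XsubC -rsE separable_Xn_sub_1.
by rewrite -rsE; apply/mxminpoly_min; rewrite rmorphB rmorphXn rmorph1 /= horner_mx_X Bk subrr.
Qed.

(* The translations of [A] are commuting permutation matrices of finite order,
   hence simultaneously diagonalizable; the diagonal entries are characters of
   [A], and a translation with only trivial entries is the identity. *)
Lemma is_charA_separates (R : realType) (A : finZmodType) (a : A) :
  a != 0 -> exists2 c : A -> R[i], is_charA c & c a != 1.
Proof.
move=> a0; pose n := #|A|.-1.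
have nE : #|A| = n.+1 by rewrite prednK //; apply/card_gt0P; exists a.
pose e (i : 'I_n.+1) : A := enum_val (cast_ord (esym nE) i).
pose e' (x : A) : 'I_n.+1 := cast_ord nE (enum_rank x).
have eK : cancel e e' by move=> i; rewrite /e /e' enum_valK cast_ordKV.
have e'K : cancel e' e by move=> x; rewrite /e /e' cast_ordK enum_rankK.
have tI b : injective (fun i => e' (e i + b)).
  by move=> i j /(can_inj e'K)/addIr/(can_inj eK).
pose p b : 'S_n.+1 := perm (@tI b).
have pD b c : p (b + c) = (p b * p c)%g.
  by apply/permP => i; rewrite permM !permE e'K addrA.
have p0 : p 0 = 1%g by apply/permP => i; rewrite permE perm1 addr0 eK.
pose B b : 'M[R[i]]_n.+1 := perm_mx (p b).
have BD b c : B (b + c) = B b *m B c by rewrite /B pD perm_mxM.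
have B0 : B 0 = 1 by rewrite /B p0 perm_mx1.
have BX b k : B (b *+ k) = B b ^+ k.
  by elim: k => [|k IH]; rewrite ?mulr0n ?B0 // mulrS exprS BD IH.
have [P Pu Pdiag] : codiagonalizable [seq B b | b <- enum A].
  apply/codiagonalizableP; split=> [_ _ /mapP[b _ ->] /mapP[c _ ->]|_ /mapP[b _ ->]].
    by rewrite /comm_mx -!BD addrC.
  apply: (@diagonalizable_of_expr_eq1 _ _ #|A|); first by rewrite nE pnatr_eq0.
  by rewrite -BX mulrn_card_eq0.
have Bd b : is_diag_mx (P *m B b *m invmx P).
  have /allP/(_ (B b)) := Pdiag; rewrite map_f ?mem_enum // => /(_ isT).
  by rewrite /= /similar_to /= conjumx.
pose c i b := (P *m B b *m invmx P) i i.
have cD i b1 b2 : c i (b1 + b2) = c i b1 * c i b2.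
  rewrite /c BD (_ : _ *m _ *m _ = (P *m B b1 *m invmx P) *m (P *m B b2 *m invmx P)).
    rewrite mxE (bigD1 i) //= big1 ?addr0 // => j ji.
    by have /is_diag_mxP -> := Bd b1; rewrite ?mul0r // eq_sym.
  by rewrite !mulmxA mulmxKV.
have c0 i : c i 0 = 1 by rewrite /c B0 mulmx1 mulmxV // mxE eqxx.
have cX i b k : c i (b *+ k) = c i b ^+ k.
  by elim: k => [|k IH]; rewrite ?mulr0n ?c0 // mulrS exprS cD IH.
have cP i : is_charA (c i).
  split=> [b|]; last exact: cD.
  (* The order of [A] kills [b], so [c i b] is a root of unity and has modulus 1. *)
  apply/eqP; rewrite -(@pexpr_eq1 _ _ #|A|) ?nE //.
  by rewrite -normrX -nE -cX mulrn_card_eq0 c0 normr1.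
have [/existsP[i ci]|/existsPn cN] := boolP [exists i, c i a != 1]; first by exists (c i).
suff a_eq0 : a = 0 by rewrite a_eq0 eqxx in a0.
have PB1 : P *m B a *m invmx P = 1%:M.
  apply/matrixP => i j; rewrite [RHS]mxE; have [<-|ij] := eqVneq i j.
    by have := cN i; rewrite negbK => /eqP.
  by have /is_diag_mxP -> := Bd a.
have Ba1 : B a = 1%:M.
  have := congr1 (fun X => invmx P *m X *m P) PB1.
  by rewrite mulmx1 mulVmx // !mulmxA mulVmx // mul1mx mulmxKV.
have pa0 : p a (e' 0) = e' 0.
  have := congr1 (fun X : 'M[R[i]]_n.+1 => X (e' 0) (p a (e' 0))) Ba1.
  rewrite /B !mxE eqxx; case: eqVneq => [//|_ /eqP]; by rewrite pnatr_eq0.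
by move: pa0; rewrite permE e'K add0r => /(can_inj e'K).
Qed.

(** * The algebra of trigonometric polynomials *)

Section TrigonometricPolynomials.
Variables (R : realType) (A : finZmodType) (M : countType).
Local Notation C := (R[i]).
Implicit Types (chi : character R A M) (x : conf A M) (f g : conf A M -> C).

Lemma is_charA0 (c : A -> C) : is_charA c -> c 0 = 1.
Proof.
move=> [c1 cD]; have c0 : c 0 != 0 by rewrite -normr_eq0 c1 oner_eq0.
by apply: (mulfI c0); rewrite mulr1 -cD addr0.
Qed.

Lemma is_charA1 : is_charA (fun _ : A => 1 : C).
Proof. by split=> *; rewrite ?normr1 ?mulr1. Qed.

Lemma is_charAM (c d : A -> C) :
  is_charA c -> is_charA d -> is_charA (fun a => c a * d a).
Proof.
move=> [c1 cD] [d1 dD]; split=> [a|a b]; first by rewrite normrM c1 d1 mulr1.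
by rewrite cD dD mulrACA.
Qed.

(** Factors outside the support are 1. Padding brings two characters onto a common list of sites,
    where they multiply factor by factor. *)
Lemma ch_eval_widen chi (S : seq M) x :
  uniq S -> {subset ch_supp chi <= S} ->
  ch_eval chi x = \prod_(m <- S) ch_comp chi m (x m).
Proof.
move=> uS sS; rewrite /ch_eval [RHS](bigID (mem (ch_supp chi))) /=.
rewrite [X in _ * X]big1 ?mulr1 => [|m /ch_suppP -> //].
rewrite -[RHS]big_filter; apply: perm_big; apply: uniq_perm.
- exact: undup_uniq.
- exact: filter_uniq.
- move=> m; rewrite mem_undup mem_filter /=.
  by case: (boolP (m \in _)) => //= /sS ->.
Qed.

Lemma ch_mul_suppP chi1 chi2 m :
  m \notin ch_supp chi1 ++ ch_supp chi2 ->
  forall a, ch_comp chi1 m a * ch_comp chi2 m a = 1.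
Proof. by rewrite mem_cat negb_or => /andP[m1 m2] a; rewrite !ch_suppP // mulr1. Qed.

Definition ch_mul chi1 chi2 : character R A M :=
  Character (fun m => is_charAM (ch_compP chi1 m) (ch_compP chi2 m))
            (@ch_mul_suppP chi1 chi2).

Lemma ch_eval_mul chi1 chi2 x :
  ch_eval (ch_mul chi1 chi2) x = ch_eval chi1 x * ch_eval chi2 x.
Proof.
pose S := undup (ch_supp chi1 ++ ch_supp chi2).
have uS : uniq S by exact: undup_uniq.
rewrite (@ch_eval_widen chi1 S) // => [|m mS]; last by rewrite mem_undup mem_cat mS.
rewrite (@ch_eval_widen chi2 S) // => [|m mS]; last by rewrite mem_undup mem_cat mS orbT.
by rewrite -big_split.
Qed.

Definition ch_one : character R A M :=
  @Character _ _ _ [::] (fun _ _ => 1) (fun _ => is_charA1) (fun _ _ _ => erefl).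

Lemma ch_coord_compP (c : A -> C) (m k : M) :
  is_charA c -> is_charA (if k == m then c else fun _ => 1).
Proof. by case: ifP => // _ _; exact: is_charA1. Qed.

Lemma ch_coord_suppP (c : A -> C) (m k : M) :
  k \notin [:: m] -> forall a, (if k == m then c else fun _ => 1) a = 1.
Proof. by rewrite inE => /negbTE ->. Qed.

Definition ch_coord (c : A -> C) (cP : is_charA c) (m : M) : character R A M :=
  Character (fun k => ch_coord_compP m k cP) (@ch_coord_suppP c m).

Lemma ch_eval_coord (c : A -> C) (cP : is_charA c) (m : M) x :
  ch_eval (ch_coord cP m) x = c (x m).
Proof. by rewrite /ch_eval /= big_seq1 eqxx. Qed.

Definition ch_comb (s : seq (C * character R A M)) x : C :=
  \sum_(p <- s) p.1 * ch_eval p.2 x.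

Definition trigpoly g := exists s, forall x, g x = ch_comb s x.

Lemma trigpoly_ext f g : (forall x, f x = g x) -> trigpoly f -> trigpoly g.
Proof. by move=> fg [s sP]; exists s => x; rewrite -fg. Qed.

Lemma trigpoly_char c chi : trigpoly (fun x => c * ch_eval chi x).
Proof. by exists [:: (c, chi)] => x; rewrite /ch_comb big_seq1. Qed.

Lemma trigpolyC c : trigpoly (fun _ => c).
Proof.
by apply: trigpoly_ext (trigpoly_char c ch_one) => x; rewrite /ch_eval /= big_nil mulr1.
Qed.

Lemma trigpolyD f g : trigpoly f -> trigpoly g -> trigpoly (fun x => f x + g x).
Proof. by move=> [s sP] [t tP]; exists (s ++ t) => x; rewrite sP tP /ch_comb big_cat. Qed.

Lemma trigpolyM f g : trigpoly f -> trigpoly g -> trigpoly (fun x => f x * g x).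
Proof.
move=> [s sP] [t tP].
exists [seq (p.1 * q.1, ch_mul p.2 q.2) | p <- s, q <- t] => x.
rewrite sP tP /ch_comb big_allpairs_dep mulr_suml; apply: eq_bigr => p _.
by rewrite mulr_sumr; apply: eq_bigr => q _; rewrite /= ch_eval_mul mulrACA.
Qed.

Lemma trigpoly_prod (I : Type) (r : seq I) (P : pred I) (f : I -> conf A M -> C) :
  (forall i, P i -> trigpoly (f i)) -> trigpoly (fun x => \prod_(i <- r | P i) f i x).
Proof.
move=> fP; elim: r => [|i r IH].
  by apply: trigpoly_ext (trigpolyC 1) => x; rewrite big_nil.
case: (boolP (P i)) => Pi.
  by apply: trigpoly_ext (trigpolyM (fP i Pi) IH) => x; rewrite big_cons Pi.
by apply: trigpoly_ext IH => x; rewrite big_cons (negbTE Pi).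
Qed.

(* Lagrange interpolation at a single site. *)
Lemma trigpoly_site m a : trigpoly (fun x => (x m == a)%:R).
Proof.
have sep b : exists f, trigpoly f /\ (a != b -> forall x,
    (x m = a -> f x = 1) /\ (x m = b -> f x = 0)).
  (* The function for [b = a] is a dummy: the product below runs over [b != a] only. *)
  have [<-|ab] := eqVneq a b; first by exists (fun _ => 0); split=> //; exact: trigpolyC.
  have [|c cP cab] := @is_charA_separates R A (a - b); first by rewrite subr_eq0.
  have cab' : c a - c b != 0.
    apply: contra cab; rewrite subr_eq0 => /eqP cacb.
    by rewrite cP.2 cacb -cP.2 subrr is_charA0.
  exists (fun x => (c (x m) - c b) / (c a - c b)); split; last first.
    by move=> _ x; split=> ->; rewrite ?divff // subrr mul0r.
  apply: trigpoly_ext (trigpolyD (trigpoly_char (c a - c b)^-1 (ch_coord cP m))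
    (trigpolyC (- c b / (c a - c b)))) => x.
  by rewrite ch_eval_coord mulrBl mulrC mulNr.
have [f fP] := choice sep.
apply: trigpoly_ext (trigpoly_prod (enum A) (P := predC1 a) (fun b _ => (fP b).1)) => x.
have [xa|xa] := eqVneq (x m) a.
  by rewrite big1 // => b /= ba; apply: ((fP b).2 _ x).1; rewrite // eq_sym.
rewrite big_enum_cond (bigD1 (x m)) //= ((fP (x m)).2 _ x).2 ?mul0r //.
by rewrite eq_sym.
Qed.

(** Lists of constraints form a countable type, as the diagonal argument over cylinders requires.
    Conflicting constraints are allowed and give the empty set. *)
Definition incyl (s : seq (M * A)) x : bool := all (fun p => x p.1 == p.2) s.

Lemma trigpoly_cyl s : trigpoly (fun x => (incyl s x)%:R).
Proof.
elim: s => [|[m a] s IH]; first exact: trigpolyC.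
apply: trigpoly_ext (trigpolyM (trigpoly_site m a) IH) => x.
by rewrite -natrM mulnb.
Qed.

End TrigonometricPolynomials.

(** * Compactness and functions of finitely many coordinates *)

Section LocalFunctions.
Variables (R : realType) (A : finZmodType) (M : countType).
Implicit Types (x y : conf A M) (S : seq M) (s t : seq (M * A)).

Definition agree S x y := forall k, k \in S -> y k = x k.

Lemma incyl_agree s x y : agree (unzip1 s) x y -> incyl s y = incyl s x.
Proof.
by move=> xy; apply: eq_in_all => p ps; rewrite xy // map_f.
Qed.

(* Compactness of [A^M], by extending an uncoverable cylinder one coordinate
   at a time along an enumeration of [M]. *)
Lemma cyl_cover_finite (U : seq (M * A) -> Prop) :
  (forall x, exists2 s, U s & incyl s x) ->
  exists S, forall x, exists s, [/\ U s, incyl s x & {subset unzip1 s <= S}].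
Proof.
(* Finitely many sites carry only finitely many distinct cylinders, so bounding the sites by [S]
   stands for choosing a finite subcover. *)
move=> Ucov; pose covered t := exists S, forall x, incyl t x ->
  exists s, [/\ U s, incyl s x & {subset unzip1 s <= S}].
suff [S SP] : covered [::] by exists S => x; exact: SP.
apply: contrapT => bad0.
(* If every value at [m] gave a covered extension, the union of the finitely many site lists would
   cover [t]. *)
have step (p : seq (M * A) * M) : exists a,
    ~ covered p.1 -> ~ covered ((p.2, a) :: p.1).
  case: p => t m /=; apply: contrapT => noa.
  have cov a : covered ((m, a) :: t).
    apply: contrapT => bad; apply: noa; exists a => _; exact: bad.
  have [Sf SfP] := choice cov; apply: noa; exists 0; case.
  exists (flatten [seq Sf a | a <- enum A]) => x tx.
  have [|s [Us sx sS]] := SfP (x m) x; first by rewrite /incyl /= eqxx.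
  exists s; split=> // k /sS kS; apply/flattenP; exists (Sf (x m)) => //.
  by apply: map_f; rewrite mem_enum.
have [g gP] := choice step.
pose ext t n := if unpickle n is Some m then (m, g (t, m)) :: t else t.
pose T := fix T n := if n is k.+1 then ext (T k) k else [::].
have badT n : ~ covered (T n).
  by elim: n => //= n IH; rewrite /ext; case: unpickle => // m; exact: (gP (T n, m)).
(* Stage [pickle m] is the one that treats [m]; the limit configuration takes the value chosen
   there. *)
pose x : conf A M := fun m => g (T (pickle m), m).
have inT n m : (pickle m < n)%N -> (m, x m) \in T n.
  elim: n => // n IH; rewrite ltnS leq_eqVlt => /predU1P[<-|mn] /=.
    by rewrite /ext pickleK inE eqxx.
  by rewrite /ext; case: unpickle => [k|]; rewrite ?inE IH ?orbT.
have [s Us sx] := Ucov x.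
(* A stage past the codes of all sites of [s]: the cylinder [T n] then lies inside [s], so [s] alone
   covers it. *)
pose n := (\max_(m <- unzip1 s) (pickle m).+1)%N.
apply: (badT n); exists (unzip1 s) => y Ty; exists s; split=> //.
rewrite (incyl_agree (x := x)) // => k ks.
have /allP/(_ (k, x k)) := Ty; rewrite inT => [/(_ isT)/eqP //|].
exact: (@leq_bigmax_seq _ (unzip1 s) predT (fun m => (pickle m).+1) k).
Qed.

(** Each point has a cylinder on which [f] varies by less than [e]. By compactness finitely many
    sites suffice, and two points agreeing on them share such a cylinder. *)
Lemma cont_fun_uniform (f : conf A M -> R) (e : R) : cont_fun f -> 0 < e ->
  exists S, forall x y, agree S x y -> `|f y - f x| < e.
Proof.
move=> fc e0; have e20 : 0 < e / 2 by rewrite divr_gt0.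
pose U s := forall x y, incyl s x -> incyl s y -> `|f y - f x| < e.
have [|S SP] := @cyl_cover_finite U.
  move=> x; have [S SP] := fc x _ e20.
  exists [seq (m, x m) | m <- S]; last by rewrite /incyl all_map; apply/allP => m _ /=.
  have near_x z : incyl [seq (m, x m) | m <- S] z -> `|f z - f x| < e / 2.
    by move=> zs; apply: SP => k kS; have /allP/(_ _ (map_f _ kS))/eqP := zs.
  move=> y z /near_x xy /near_x xz; rewrite -(subrKA (f x)) (splitr e).
  by rewrite (le_lt_trans (ler_normD _ _)) // ltrD // distrC.
exists S => x y xy; have [s [Us sx sS]] := SP x.
by apply: Us => //; rewrite (incyl_agree (x := x)) // => k /sS; exact: xy.
Qed.

Definition local S (f : conf A M -> R) := forall x y, agree S x y -> f y = f x.

Definition cyl_comb (l : seq (R * seq (M * A))) x : R :=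
  \sum_(p <- l) p.1 * (incyl p.2 x)%:R.

(** Induction on [S], splitting over the value at the head site. Keeping the site list equal to [S]
    lets the Haar measure evaluate each cylinder when [S] has no duplicates. *)
Lemma local_cyl_comb S f : local S f ->
  exists2 l, (forall x, f x = cyl_comb l x) & forall p, p \in l -> unzip1 p.2 = S.
Proof.
elim: S f => [|m S IH] f fS.
  exists [:: (f (fun _ => 0), [::])] => [x|p]; last by rewrite inE => /eqP ->.
  by rewrite /cyl_comb big_seq1 mulr1; apply: fS.
pose upd a x : conf A M := fun k => if k == m then a else x k.
have IH' a : exists l, (forall x, f (upd a x) = cyl_comb l x) /\
    forall p, p \in l -> unzip1 p.2 = S.
  have [|l l1 l2] := IH (fun x => f (upd a x)); last by exists l.
  move=> x y xy; apply: fS => k; rewrite inE /upd; case: eqP => //= _; exact: xy.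
have [l lP] := choice IH'.
exists [seq (p.1, (m, a) :: p.2) | a <- enum A, p <- l a] => [x|p]; last first.
  by move=> /allpairsPdep[a [q [_ /(lP a).2 <- ->]]].
rewrite /cyl_comb big_allpairs_dep big_enum (bigD1 (x m)) //= [X in _ + X]big1.
  have -> : f x = f (upd (x m) x).
    by congr f; apply/funext => k; rewrite /upd; case: eqP => [->|].
  rewrite addr0 (lP (x m)).1.
  by apply: eq_bigr => p _; rewrite /incyl /= eqxx.
move=> a /negbTE; rewrite eq_sym => xa; apply: big1 => p _.
by rewrite /incyl /= xa mulr0.
Qed.

(** Zeroing the coordinates outside [S] makes any function local; for a continuous one and [S] from
    [cont_fun_uniform] the error is uniformly small. *)
Definition restr S x : conf A M := fun k => if k \in S then x k else 0.

Lemma agree_restr S x : agree S x (restr S x).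
Proof. by move=> k kS; rewrite /restr kS. Qed.

Lemma local_restr S f : local S (fun x => f (restr S x)).
Proof.
move=> x y xy; congr f; apply/funext => k; rewrite /restr.
by case: ifP => // /xy.
Qed.

End LocalFunctions.

(** * Measurability and integrability *)

Section BoundedMeasurable.
Variables (R : realType) (A : finZmodType) (M : countType).
Local Notation X := (cfg A M).
Implicit Types (f g : X -> R) (S : seq M) (s : seq (M * A)) (nu : probability X R).

(** A class stable under sums, products and measurable substitutions, and integrable for every
    probability. *)
Definition bounded_measurable f :=
  measurable_fun [set: X] f /\ exists B : R, forall x, `|f x| <= B.
Local Notation bm := bounded_measurable.

Lemma measurable_incyl s : measurable [set x : X | incyl s x].
Proof.
elim: s => [|[m a] s IH]; first by rewrite (_ : mkset _ = setT) //; apply/seteqP.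
rewrite (_ : mkset _ = [set x : X | x m = a] `&` [set x : X | incyl s x]).
  by apply: measurableI => //; apply: sub_sigma_algebra; exists m, a.
apply/seteqP; split=> x; rewrite /incyl /=; first by case/andP => /eqP.
by case=> -> ->; rewrite eqxx.
Qed.

Lemma bm_cst c : bm (fun _ => c).
Proof. by split; [exact: measurable_cst|exists `|c|]. Qed.

Lemma bmD f g : bm f -> bm g -> bm (fun x => f x + g x).
Proof.
move=> [mf [B fB]] [mg [D gD]]; split; first exact: measurable_funD.
by exists (B + D) => x; rewrite (le_trans (ler_normD _ _)) // lerD.
Qed.

Lemma bmM f g : bm f -> bm g -> bm (fun x => f x * g x).
Proof.
move=> [mf [B fB]] [mg [D gD]]; split; first exact: measurable_funM.
by exists (B * D) => x; rewrite normrM ler_pM.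
Qed.

Lemma bm_sum (I : Type) (l : seq I) (h : I -> X -> R) :
  (forall i, bm (h i)) -> bm (fun x => \sum_(i <- l) h i x).
Proof.
move=> hP; elim: l => [|i l IH].
  rewrite (_ : (fun _ => _) = fun _ => 0); first exact: bm_cst.
  by apply/funext => x; rewrite big_nil.
rewrite (_ : (fun _ => _) = fun x => h i x + \sum_(j <- l) h j x); first exact: bmD.
by apply/funext => x; rewrite big_cons.
Qed.

Lemma indic_incyl s : (fun x : X => (incyl s x)%:R) = \1_[set x : X | incyl s x] :> (X -> R).
Proof.
apply/funext => x; rewrite indicE; congr ((nat_of_bool _)%:R); apply/esym.
by case: (boolP (incyl s x)) => xs; [apply/mem_set|apply/memNset; apply/negP].
Qed.

Lemma bm_incyl s : bm (fun x => (incyl s x)%:R).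
Proof.
split; last by exists 1 => x; case: incyl; rewrite ?normr1 ?normr0.
by rewrite indic_incyl; apply: measurable_indic; exact: measurable_incyl.
Qed.

Lemma bm_local S f : local S f -> bm f.
Proof.
move=> /local_cyl_comb[l lE _]; rewrite (_ : f = cyl_comb l); last exact/funext.
by apply: bm_sum => p; apply: bmM; [exact: bm_cst|exact: bm_incyl].
Qed.

(** The local functions [h n] converge uniformly to [f], which gives measurability; boundedness
    follows since [f] is within 1 of [h 0]. *)
Lemma bm_cont f : cont_fun f -> bm f.
Proof.
move=> fc.
have [S SP] := choice (fun n => cont_fun_uniform fc (divr_gt0 ltr01 (ltr0Sn R n))).
pose h n (x : X) : R := f (restr (S n) x).
have hP n : bm (h n) by apply: bm_local; exact: local_restr.
have hf n x : `|h n x - f x| < 1 / n.+1%:R by apply: SP; exact: agree_restr.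
split.
  apply: (@measurable_fun_cvg _ _ _ _ h) => [n|x _]; first exact: (hP n).1.
  apply/cvgrPdist_lt => e e0; near=> n.
  rewrite distrC; apply: lt_trans (hf n x) _; rewrite div1r.
  by near: n; exact: near_infty_natSinv_lt (PosNum e0).
have [_ [B hB]] := hP 0; exists (B + 1) => x.
rewrite -(subrK (h 0 x) (f x)) addrC (le_trans (ler_normD _ _)) // lerD //.
by rewrite distrC ltW // (lt_le_trans (hf 0 x)) // divr1.
Unshelve. all: by end_near. Qed.

Lemma bm_comp (T : X -> X) f : measurable_fun setT T -> bm f -> bm (f \o T).
Proof.
move=> mT [mf [B fB]]; split; first exact: measurableT_comp.
by exists B => x /=.
Qed.

(** Preimages of generating cylinders suffice, and the indicator of [F x m = a] is continuous, hence
    measurable. *)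
Lemma measurable_cont_map (F : conf A M -> conf A M) :
  cont_map F -> measurable_fun [set: X] (F : X -> X).
Proof.
move=> Fc; apply: (@measurability _ _ X X setT (F : X -> X) (cyl A M)) => //.
move=> _ [_ [m [a ->]] <-]; rewrite setTI.
pose f (x : X) : R := (F x m == a)%:R.
have [mf _] : bm f.
  apply: bm_cont => x e e0; have [S SP] := Fc x m; exists S => y xy.
  by rewrite /f SP // subrr normr0.
rewrite (_ : _ @^-1` _ = [set: X] `&` f @^-1` [set 1]).
  by apply: mf => //; exact: measurable_set1.
rewrite setTI /f; apply/seteqP; split=> x /=; first by move=> ->; rewrite eqxx.
by case: eqP => // _ /esym/eqP; rewrite oner_eq0.
Qed.

Lemma measurable_iter (F : X -> X) n :
  measurable_fun setT F -> measurable_fun setT (iter n F).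
Proof.
move=> mF; elim: n => [|n IH]; first exact: measurable_id.
exact: (measurableT_comp mF IH).
Qed.

Lemma bm_integrable nu f : bm f -> nu.-integrable setT (EFin \o f).
Proof.
move=> [mf [B fB]]; apply: measurable_bounded_integrable => //.
  by apply: (@le_lt_trans _ _ 1%E); [exact: probability_le1|exact: ltry].
by exists B; split; rewrite ?num_real // => y By x _; apply: le_trans (fB x) _; exact: ltW.
Qed.

Lemma bm_integralE nu f : bm f ->
  (\int[nu]_x (f x)%:E = (\int[nu]_x f x)%:E)%E.
Proof.
by move=> /(bm_integrable nu) fi; rewrite /Rintegral fineK // integrable_fin_num.
Qed.

Lemma bm_Rintegral_sum nu (I : Type) (l : seq I) (c : I -> R) (h : I -> X -> R) :
  (forall i, bm (h i)) ->
  \int[nu]_x (\sum_(i <- l) c i * h i x) = \sum_(i <- l) c i * \int[nu]_x h i x.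
Proof.
move=> hP; elim: l => [|i l IH].
  under eq_Rintegral do rewrite big_nil.
  by rewrite Rintegral_cst // mul0r big_nil.
under eq_Rintegral do rewrite big_cons.
rewrite big_cons -IH RintegralD //; first by rewrite RintegralZl //; exact: bm_integrable.
  by apply: bm_integrable; apply: bmM => //; exact: bm_cst.
by apply: bm_integrable; apply: bm_sum => j; apply: bmM => //; exact: bm_cst.
Qed.

Lemma Rintegral_incyl nu s :
  \int[nu]_x (incyl s x)%:R = fine (nu [set x : X | incyl s x]).
Proof.
rewrite /Rintegral; congr fine.
under eq_integral do rewrite (congr1 (fun h => h _) (indic_incyl s)).
by rewrite integral_indic ?setIT //; exact: measurable_incyl.
Qed.

Lemma probability_Rintegral_cst nu (c : R) : \int[nu]_x c = c.
Proof.
rewrite Rintegral_cst // -[RHS]mulr1; congr (_ * _).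
exact: (congr1 fine (probability_setT nu)).
Qed.

Lemma bm_Rintegral_dist nu f g e : bm f -> bm g ->
  (forall x, `|f x - g x| <= e) -> `|\int[nu]_x f x - \int[nu]_x g x| <= e.
Proof.
move=> fP gP fg; have fi := bm_integrable nu fP; have gi := bm_integrable nu gP.
have hP : bm (fun x => f x - g x).
  rewrite (_ : (fun _ => _) = fun x => f x + -1 * g x).
    by apply: bmD => //; apply: bmM => //; exact: bm_cst.
  by apply/funext => x; rewrite mulN1r.
rewrite -RintegralB // (le_trans (le_normr_Rintegral _ (bm_integrable nu hP))) //.
have -> : e = \int[nu]_(x in setT) e.
  exact/esym/probability_Rintegral_cst.
apply: le_Rintegral => //; last by apply: (bm_integrable nu); exact: bm_cst.
apply: (bm_integrable nu (f := fun x => `|f x - g x|)); split.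
  exact: measurableT_comp hP.1.
by exists e => x; rewrite normr_id.
Qed.

End BoundedMeasurable.

(** * Integrals of characters and the Haar measure *)

Section CharacterIntegrals.
Variables (R : realType) (A : finZmodType) (M : countType).
Local Notation X := (cfg A M).
Local Notation C := (R[i]).
Local Notation bm := bounded_measurable.
Implicit Types (chi : character R A M) (nu eta : probability X R) (g : X -> C).

Lemma Re_mulc (z w : C) : complex.Re (z * w) =
  complex.Re z * complex.Re w - complex.Im z * complex.Im w.
Proof. by case: z => a b; case: w. Qed.

Lemma Im_mulc (z w : C) : complex.Im (z * w) =
  complex.Re z * complex.Im w + complex.Im z * complex.Re w.
Proof. by case: z => a b; case: w. Qed.

Lemma bm_Rintegral_lin nu (a b : R) (f h : X -> R) : bm f -> bm h ->
  \int[nu]_x (a * f x + b * h x) = a * \int[nu]_x f x + b * \int[nu]_x h x.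
Proof.
move=> fP hP.
have cP (c : R) k : bm k -> bm (fun x : X => c * k x).
  by move=> kP; apply: bmM => //; exact: bm_cst.
rewrite RintegralD // ?RintegralZl //; apply: bm_integrable => //; exact: cP.
Qed.

Lemma cintegralZ nu (c : C) g :
  bm (fun x => complex.Re (g x)) -> bm (fun x => complex.Im (g x)) ->
  cintegral nu (fun x => c * g x) = c * cintegral nu g.
Proof.
move=> rP iP; apply/eqP; rewrite eq_complex; apply/andP; split; apply/eqP.
  rewrite Re_mulc /= -mulNr -bm_Rintegral_lin //; congr fine.
  by apply: eq_integral => x _; rewrite Re_mulc mulNr.
rewrite Im_mulc /= -bm_Rintegral_lin //; congr fine.
by apply: eq_integral => x _; rewrite Im_mulc.
Qed.

Lemma cintegral_ext nu g h : (forall x, g x = h x) -> cintegral nu g = cintegral nu h.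
Proof. by move=> gh; congr cintegral; apply/funext. Qed.

Lemma ch_eval_agree chi (x y : conf A M) :
  agree (ch_supp chi) x y -> ch_eval chi y = ch_eval chi x.
Proof.
by move=> xy; apply: eq_big_seq => m; rewrite mem_undup => /xy ->.
Qed.

Lemma bm_Re_char chi : bm (fun x : X => complex.Re (ch_eval chi x)).
Proof.
by apply: (@bm_local _ _ _ (ch_supp chi)) => x y /ch_eval_agree ->.
Qed.

Lemma bm_Im_char chi : bm (fun x : X => complex.Im (ch_eval chi x)).
Proof.
by apply: (@bm_local _ _ _ (ch_supp chi)) => x y /ch_eval_agree ->.
Qed.

Lemma Re_sum (I : Type) (l : seq I) (h : I -> C) :
  complex.Re (\sum_(i <- l) h i) = \sum_(i <- l) complex.Re (h i).
Proof. exact: raddf_sum. Qed.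

(** Expresses the integral of a real function through complex character integrals; [T] will be an
    iterate of the automaton. *)
Lemma Rintegral_Re_ch_comb nu (T : X -> X) (l : seq (C * character R A M)) :
  measurable_fun setT T ->
  \int[nu]_x complex.Re (ch_comb l (T x)) =
  \sum_(p <- l) complex.Re (p.1 * cintegral nu (fun x => ch_eval p.2 (T x))).
Proof.
move=> mT.
pose h (p : C * character R A M) (x : X) : R := complex.Re (p.1 * ch_eval p.2 (T x)).
have rP chi : bm (fun x => complex.Re (ch_eval chi (T x))).
  exact: (bm_comp mT (bm_Re_char chi)).
have iP chi : bm (fun x => complex.Im (ch_eval chi (T x))).
  exact: (bm_comp mT (bm_Im_char chi)).
transitivity (\int[nu]_x \sum_(p <- l) 1 * h p x).
  apply: eq_Rintegral => x _; rewrite Re_sum.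
  by apply: eq_bigr => p _; rewrite mul1r.
rewrite bm_Rintegral_sum => [|[c chi]].
  by apply: eq_bigr => p _; rewrite mul1r -cintegralZ.
rewrite /h /= (_ : (fun _ => _) = fun x => complex.Re c * complex.Re (ch_eval chi (T x))
    + - complex.Im c * complex.Im (ch_eval chi (T x))).
  by apply: bmD; apply: bmM => //; exact: bm_cst.
by apply/funext => x; rewrite Re_mulc mulNr.
Qed.

Lemma cintegral_trivial nu chi (T : X -> X) :
  ~ ch_nontrivial chi -> cintegral nu (fun x => ch_eval chi (T x)) = 1.
Proof.
move=> triv; have chi1 x : ch_eval chi x = 1.
  by apply/eqP; apply: contrapT => /negP xn; apply: triv; exists x.
rewrite (cintegral_ext _ (h := fun _ => 1)) //.
have E0 := probability_Rintegral_cst nu (0 : R).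
have E1 := probability_Rintegral_cst nu (1 : R).
by apply/eqP; rewrite eq_complex; apply/andP; split; apply/eqP.
Qed.

(** [is_haar] describes a cylinder by a configuration and [incyl] by constraints; this configuration
    links the two. *)
Definition cyl_point (s : seq (M * A)) : conf A M :=
  foldr (fun p b k => if k == p.1 then p.2 else b k) (fun _ => 0) s.

Lemma incyl_cyl_point s : uniq (unzip1 s) -> incyl s (cyl_point s).
Proof.
elim: s => // -[m a] s IH /= /andP[ms us]; rewrite /incyl /= !eqxx.
have := IH us; rewrite -(@incyl_agree _ _ s (cyl_point s) (cyl_point ((m, a) :: s))) //.
by move=> k ks /=; case: eqP ks => // ->; rewrite (negbTE ms).
Qed.

Lemma haar_incyl eta s : is_haar eta -> uniq (unzip1 s) ->
  \int[eta]_x (incyl s x)%:R = (#|A|%:R : R) ^- size s.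
Proof.
move=> etaH us; rewrite Rintegral_incyl -(size_map fst) -[RHS]/(fine _%:E).
rewrite -(etaH _ (cyl_point s) us); congr (fine (eta _)).
have sb := incyl_cyl_point us.
apply/seteqP; split=> x /= => [xs m /mapP[p ps ->]|xs].
  by have /allP/(_ _ ps)/eqP -> := xs; have /allP/(_ _ ps)/eqP -> := sb.
by rewrite (incyl_agree (x := cyl_point s)).
Qed.

(** Translation changes the prescribed values of a cylinder but not its sites, and the Haar measure
    depends only on their number. *)
Lemma haar_translate eta (S : seq M) (f : conf A M -> R) (t : conf A M) :
  is_haar eta -> local S f ->
  \int[eta]_x f (caddf x t) = \int[eta]_x f x.
Proof.
move=> etaH fS.
(* [is_haar] speaks of duplicate-free site lists only, hence [undup]. *)
have [|l lE lS] := @local_cyl_comb _ _ _ (undup S) f.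
  by move=> x y xy; apply: fS => k kS; apply: xy; rewrite mem_undup.
pose tr (s : seq (M * A)) := [seq (p.1, p.2 - t p.1) | p <- s].
have trE s x : incyl s (caddf x t) = incyl (tr s) x.
  rewrite /incyl all_map; apply: eq_all => p /=.
  by rewrite /caddf eq_sym -subr_eq eq_sym.
have tr1 s : unzip1 (tr s) = unzip1 s by rewrite /unzip1 -map_comp.
under eq_Rintegral do rewrite lE /cyl_comb.
under [RHS]eq_Rintegral do rewrite lE /cyl_comb.
rewrite !bm_Rintegral_sum; try by move=> p; exact: bm_incyl.
  apply: eq_big_seq => p /lS pS; congr (_ * _).
  under eq_Rintegral do rewrite trE.
  by rewrite !haar_incyl ?tr1 ?pS ?undup_uniq // size_map.
move=> p; rewrite (_ : (fun _ => _) = fun x : X => (incyl (tr p.2) x)%:R).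
  exact: bm_incyl.
by apply/funext => x; rewrite trE.
Qed.

(* A translation moving [chi] by a factor [z != 1] preserves [eta], so the
   integral [I] of [chi] satisfies [I = z * I]. *)
Lemma haar_char eta chi : is_haar eta -> ch_nontrivial chi ->
  cintegral eta (ch_eval chi) = 0.
Proof.
move=> etaH [t tn]; set I := cintegral _ _.
have chiD x : ch_eval chi (caddf x t) = ch_eval chi t * ch_eval chi x.
  rewrite mulrC /ch_eval -big_split; apply: eq_bigr => m _.
  by have [_ ->] := ch_compP chi m.
have : ch_eval chi t * I = I.
  rewrite /I -cintegralZ; [|exact: bm_Re_char|exact: bm_Im_char].
  rewrite (cintegral_ext _ (h := fun x => ch_eval chi (caddf x t))) //.
  apply/eqP; rewrite eq_complex; apply/andP; split; apply/eqP.
    apply: (@haar_translate _ (ch_supp chi) (fun x => complex.Re (ch_eval chi x))) => //.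
    by move=> x y /ch_eval_agree ->.
  apply: (@haar_translate _ (ch_supp chi) (fun x => complex.Im (ch_eval chi x))) => //.
  by move=> x y /ch_eval_agree ->.
move/eqP; rewrite -subr_eq0 -[X in _ - X]mul1r -mulrBl mulf_eq0 subr_eq0.
by rewrite (negbTE tn) => /eqP.
Qed.

End CharacterIntegrals.

(** * Sets of density one and Cesaro means *)

Section Density.
Variable R : realType.
Implicit Types (J K : pred nat) (e : R).

Lemma count_iota_le J N : (count J (iota 1 N) <= N)%N.
Proof. by rewrite -[leqRHS](size_iota 1) count_size. Qed.

(** The count never exceeds [N], so only the lower bound carries information; without division it
    also makes sense at [N = 0]. *)
Lemma density_oneP J : density_one R J <->
  forall e, 0 < e -> exists N0, forall N, (N0 <= N)%N ->
    (1 - e) * N%:R <= (count J (iota 1 N))%:R.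
Proof.
split=> [/cvgrPdist_lt dJ e e0|dJ].
  have [N0 _ N0P] := dJ _ e0; exists N0 => -[|N] N0N; first by rewrite mulr0.
  have := N0P N.+1 N0N => /=; rewrite ltr_distlC => /andP[/ltW + _].
  by rewrite ler_pdivlMr ?ltr0Sn.
apply/cvgrPdist_le => e e0; have [N0 N0P] := dJ e e0.
exists (maxn N0 1) => // N /=; rewrite geq_max => /andP[N0N N1].
have NR : 0 < N%:R :> R by rewrite ltr0n.
rewrite ler_distlC ler_pdivlMr // N0P // ler_pdivrMr //.
rewrite (le_trans (_ : _ <= N%:R)) ?ler_nat ?count_iota_le //.
by rewrite ler_peMl ?ltW // ltrDl.
Qed.

Lemma density_oneT : density_one R predT.
Proof.
apply/density_oneP => e e0; exists 0 => N _.
by rewrite count_predT size_iota ler_piMl // gerBl ltW.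
Qed.

(** Inclusion-exclusion: the union has at most [N] elements up to [N], so the two deficits [e / 2]
    add up to at most [e]. *)
Lemma density_oneI J K :
  density_one R J -> density_one R K -> density_one R (predI J K).
Proof.
move=> /density_oneP dJ /density_oneP dK; apply/density_oneP => e e0.
have e20 : 0 < e / 2 by rewrite divr_gt0.
have [N1 N1P] := dJ _ e20; have [N2 N2P] := dK _ e20.
exists (maxn N1 N2) => N; rewrite geq_max => /andP[/N1P cJ /N2P cK].
have := count_predUI J K (iota 1 N).
move/(congr1 (fun n => n%:R : R)); rewrite !natrD => /eqP.
rewrite addrC eq_sym -subr_eq => /eqP <-.
have : (count (predU J K) (iota 1 N))%:R <= N%:R :> R by rewrite ler_nat count_iota_le.
by move: cJ cK; lra.
Qed.

Lemma density_one_all (I : Type) (l : seq I) (J : I -> pred nat) :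
  (forall i, density_one R (J i)) -> density_one R (fun n => all (fun i => J i n) l).
Proof.
move=> dJ; elim: l => [|i l IH]; first exact: density_oneT.
exact: density_oneI (dJ i) IH.
Qed.

(* [K] follows ever larger finite intersections of the [J k], moving on to the
   next one only once its density is close enough to one. *)
Lemma density_one_diag (J : nat -> pred nat) : (forall k, density_one R (J k)) ->
  exists2 K, density_one R K &
    forall k, exists N, forall n, (N <= n)%N -> K n -> J k n.
Proof.
move=> dJ; pose J' k n := all (fun i => J i n) (iota 0 k).
have J'S k l n : (k <= l)%N -> J' l n -> J' k n.
  by move=> kl; rewrite /J' -(subnKC kl) iotaD all_cat => /andP[].
have dJ' k : exists N, forall n, (N <= n)%N ->
    (1 - k.+1%:R^-1) * n%:R <= (count (J' k) (iota 1 n))%:R :> R.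
  by have /density_oneP := density_one_all (iota 0 k) dJ; apply; rewrite invr_gt0.
have [N NP] := choice dJ'.
(* The largest [k <= n] whose density threshold [N k] has been passed, and 0 if there is none; for
   [k = 0] the density bound reads [0 <= _]. *)
pose kap n := (\max_(k < n.+1 | (N k <= n)%N) k)%N.
have kap_ge k n : (maxn k (N k) <= n)%N -> (k <= kap n)%N.
  rewrite geq_max => /andP[kn Nkn].
  exact: (@leq_bigmax_cond _ (fun i : 'I_n.+1 => (N i <= n)%N) (@nat_of_ord _)
    (Ordinal (kn : (k < n.+1)%N)) Nkn).
have kapM m n : (m <= n)%N -> (kap m <= kap n)%N.
  move=> mn; apply/bigmax_leqP => i Ni; apply: kap_ge.
  by rewrite geq_max (leq_trans Ni mn) andbT (leq_trans _ mn) // -ltnS.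
have kapP n : (1 - (kap n).+1%:R^-1) * n%:R <= (count (J' (kap n)) (iota 1 n))%:R :> R.
  rewrite /kap; elim/big_ind: _ => [|a b ha hb|i Ni]; last exact: NP.
  - by rewrite invr1 subrr mul0r.
  - by rewrite /maxn; case: ifP.
exists (fun n => J' (kap n) n); last first.
  (* [J' k] involves the indices below [k], so [J k] enters at [k.+1]. *)
  move=> k; exists (maxn k.+1 (N k.+1)) => n /kap_ge kn /(J'S _ _ _ kn).
  by rewrite /J' -addn1 iotaD all_cat /= andbT add0n => /andP[].
apply/density_oneP => e e0.
have [k ke] : exists k, k.+1%:R^-1 <= e.
  have [k _ kP] := near_infty_natSinv_lt (PosNum e0); exists k.
  by apply/ltW/kP => /=.
exists (maxn k (N k)) => n /kap_ge kn.
apply: le_trans (le_trans (kapP n) _).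
  rewrite ler_wpM2r // lerB // (le_trans _ ke) // lef_pV2 ?posrE ?ltr0Sn //.
  by rewrite ler_nat.
(* Since [kap] is monotone and [J'] decreasing, up to time [n] the new set contains [J' (kap n)]. *)
rewrite ler_nat -!size_filter; apply: uniq_leq_size => [|i]; first exact/filter_uniq/iota_uniq.
rewrite !mem_filter => /andP[Ji ini]; rewrite ini andbT.
by apply: J'S Ji; apply: kapM; move: ini; rewrite mem_iota add1n ltnS => /andP[].
Qed.

(** Times in [J] past [N0] contribute at most [e / 4] on average; times outside [J] and times before
    [N0] have small frequency and bounded terms, giving [e / 4] each. *)
Lemma cesaro_density (u : nat -> R) (a B : R) J :
  (forall n, `|u n| <= B) -> density_one R J ->
  u @ within [set j | J j] \oo --> a ->
  (fun N => N%:R^-1 * \sum_(1 <= n < N.+1) u n) @ \oo --> a.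
Proof.
move=> uB dJ /cvgrPdist_lt ua; apply/cvgrPdist_lt => e e0.
have e40 : 0 < e / 4 by rewrite divr_gt0.
have B0 : 0 <= B by rewrite (le_trans _ (uB 0)).
(* The summand 1 makes [D] positive, so that one can divide by it. *)
pose D := B + `|a| + 1; have D0 : 0 < D by rewrite ltr_wpDl // addr_ge0.
have uD n : `|a - u n| <= D.
  by have := uB n; have := ler_normB a (u n); rewrite /D; lra.
have [N0 _ N0P] := ua _ e40.
have d0 : 0 < e / 4 / D by rewrite divr_gt0.
have [N1 N1P] := (density_oneP J).1 dJ _ d0.
have [N2 _ N2P] : \forall N \near \oo, N0%:R < e / 4 / D * N%:R.
  near=> N; rewrite mulrC -ltr_pdivrMr //.
  by near: N; exact: nbhs_infty_gtr.
exists (maxn (maxn N1 N2) 1) => // N /=.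
rewrite !geq_max -andbA => /and3P[/N1P cJ /N2P/= N0N N_gt0].
have NR : 0 < N%:R :> R by rewrite ltr0n.
have split_term n : `|a - u n| <= e / 4 + D * (~~ J n)%:R + D * (n < N0)%N%:R.
  have [n0|n0] := ltnP n N0.
    by rewrite mulr1 (le_trans (uD n)) // lerDr addr_ge0 ?mulr_ge0 // ltW.
  rewrite mulr0 addr0; case: (boolP (J n)) => [Jn|_].
    by rewrite mulr0 addr0 ltW // N0P.
  by rewrite mulr1 (le_trans (uD n)) // lerDr ltW.
have -> : a - N%:R^-1 * \sum_(1 <= n < N.+1) u n =
    N%:R^-1 * \sum_(1 <= n < N.+1) (a - u n).
  rewrite sumrB mulrBr sumr_const_nat subSS subn0 -[a *+ N]mulr_natl mulKf //.
  by rewrite gt_eqF.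
rewrite normrM normfV (gtr0_norm NR) ltr_pdivrMl // mulrC.
apply: le_lt_trans (ler_norm_sum _ _ _) _.
apply: le_lt_trans (ler_sum _ (fun n _ => split_term n)) _.
rewrite !big_split /= -!mulr_sumr sumr_const_nat subSS subn0.
have sumE K : \sum_(1 <= n < N.+1) (K n)%:R = (count K (iota 1 N))%:R :> R.
  rewrite -natr_sum; congr (_%:R).
  rewrite -sum1_count [RHS]big_mkcond /index_iota subSS subn0.
  by apply: eq_bigr => n _; case: (K n).
rewrite (sumE (predC J)) (sumE (fun n => (n < N0)%N)) -mulr_natr.
have cN0 : (count (fun n => n < N0)%N (iota 1 N))%:R <= N0%:R :> R.
  rewrite ler_nat -size_filter -[leqRHS](size_iota 0); apply: uniq_leq_size.
    exact/filter_uniq/iota_uniq.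
  by move=> n; rewrite mem_filter !mem_iota /= add0n => /andP[].
have cC : (count J (iota 1 N))%:R + (count (predC J) (iota 1 N))%:R = N%:R :> R.
  by rewrite -natrD count_predC size_iota.
have DJ : D * (count (predC J) (iota 1 N))%:R <= e / 4 * N%:R.
  by rewrite mulrC -ler_pdivlMr // mulrAC; move: cJ cC; lra.
have DN : D * (count (fun n => n < N0)%N (iota 1 N))%:R <= e / 4 * N%:R.
  rewrite mulrC -ler_pdivlMr // mulrAC; exact: le_trans cN0 (ltW N0N).
have : 0 < e * N%:R by rewrite mulr_gt0.
by move: DJ DN; lra.
Unshelve. all: by end_near. Qed.

End Density.

(** * From characters to cylinders to continuous functions *)

Section Convergence.
Variables (R : realType) (A : finZmodType) (M : countType).
Local Notation X := (cfg A M).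
Local Notation C := (R[i]).
Local Notation bm := bounded_measurable.
Variables (F : X -> X) (mF : measurable_fun setT F) (mu eta : probability X R).
Implicit Types (f : X -> R) (chi : character R A M).

Let mI n : measurable_fun setT (iter n F) := measurable_iter n mF.

Lemma integral_pushF f n : bm f ->
  (\int[pushF mu F n]_x (f x)%:E = (\int[mu]_x f (iter n F x))%:E)%E.
Proof.
move=> fP; have fnP : bm (f \o iter n F) by exact: bm_comp.
rewrite -(bm_integralE _ fnP).
apply: (@integral_pushforward _ _ X X R _ (mI n) mu setT (EFin \o f)) => //.
  by apply/measurable_EFinP; exact: fP.1.
exact: (bm_integrable mu fnP).
Qed.

Lemma bm_pos f : bm f -> bm (fun x => Num.max (f x) 0).
Proof.
move=> [mf [B fB]]; split; first exact: measurable_maxr.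
exists B => x; have := fB x; case: (leP (f x) 0) => // _ /(le_trans (normr_ge0 _)).
by rewrite normr0.
Qed.

(** The average is defined as a bare set function; realising it as a scaled sum of pushforward
    measures gives access to additivity of the integral in the measure. *)
Lemma cesaro_avg_measure N : {m : measure X R | cesaro_avg mu F N = m &
  forall f, bm f -> (forall x, 0 <= f x) -> (\int[m]_x (f x)%:E =
    (N%:R^-1 * \sum_(1 <= n < N.+1) \int[mu]_x f (iter n F x))%:E)%E}.
Proof.
(* The average starts at time 1, the sum of measures at index 0. *)
pose m_ n : measure X R :=
  measure_function_pushforward__canonical__measure_function_Measure mu (mI n.+1).
have N0 : 0 <= N%:R^-1 :> R by rewrite invr_ge0.
exists (mscale (NngNum N0) (msum m_ N)) => [|f fP f0].
  apply/funext => B; rewrite /cesaro_avg /mscale /=; congr (_ * _)%E.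
  by rewrite big_add1 big_mkord.
have mf : measurable_fun setT (EFin \o f) by apply/measurable_EFinP; exact: fP.1.
rewrite ge0_integral_mscale //; last by move=> x _; rewrite lee_fin.
rewrite ge0_integral_measure_sum //; last by move=> x _; rewrite lee_fin.
rewrite EFinM big_add1 big_mkord -sumEFin /=; congr (_ * _)%E.
by apply: eq_bigr => i _; exact: integral_pushF.
Qed.

(** Splitting [f] into positive and negative parts reduces to the nonnegative case. *)
Lemma integral_cesaro_avg f N : bm f ->
  (\int[cesaro_avg mu F N]_x (f x)%:E =
   (N%:R^-1 * \sum_(1 <= n < N.+1) \int[mu]_x f (iter n F x))%:E)%E.
Proof.
move=> fP.
have nP : bm (fun x => - f x).
  rewrite (_ : (fun _ => _) = fun x => -1 * f x); last by apply/funext => x; rewrite mulN1r.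
  by apply: bmM => //; exact: bm_cst.
have pos_ge0 (h : X -> R) x : 0 <= Num.max (h x) 0 by rewrite le_max lexx orbT.
have [m -> mE] := cesaro_avg_measure N; rewrite integralE.
under eq_integral do rewrite funeposE -EFin_max.
under [X in (_ - X)%E]eq_integral do rewrite funenegE -EFinN -EFin_max.
have pP := bm_pos fP; have qP := bm_pos nP.
rewrite (mE _ pP (pos_ge0 f)) (mE _ qP (pos_ge0 (fun x => - f x))).
rewrite -EFinB -mulrBr -sumrB; congr (_ * _)%:E; apply: eq_bigr => n _.
have pi := bm_integrable mu (bm_comp (mI n) pP).
have qi := bm_integrable mu (bm_comp (mI n) qP).
rewrite -(RintegralB _ pi qi) //; apply: eq_Rintegral => x _ /=.
by case: (leP (f (iter n F x)) 0); case: (leP (- f (iter n F x)) 0); lra.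
Qed.

Lemma cvg_sum_seq (I : eqType) (l : seq I) (Flt : set_system nat) {FF : Filter Flt}
    (u : I -> nat -> R) (a : I -> R) :
  (forall i, i \in l -> u i @ Flt --> a i) ->
  (fun n => \sum_(i <- l) u i n) @ Flt --> \sum_(i <- l) a i.
Proof.
elim: l => [|i l IH] ul.
  rewrite big_nil (_ : (fun _ => _) = fun _ => 0); first exact: cvg_cst.
  by apply/funext => n; rewrite big_nil.
rewrite big_cons (_ : (fun _ => _) = fun n => u i n + \sum_(j <- l) u j n).
  apply: cvgD; first by apply: ul; rewrite mem_head.
  by apply: IH => j jl; apply: ul; rewrite inE jl orbT.
by apply/funext => n; rewrite big_cons.
Qed.

(** Replacing [f] by a local [g] costs [e / 4] on each side, and [g] is a finite combination of
    cylinder indicators, whose integrals converge. *)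
Lemma cyl_cvg_cont (Flt : set_system nat) {FF : Filter Flt} f :
  (forall s, (fun n => \int[mu]_x (incyl s (iter n F x))%:R) @ Flt -->
             (\int[eta]_x (incyl s x)%:R : R)) ->
  cont_fun f ->
  (fun n => \int[mu]_x f (iter n F x)) @ Flt --> \int[eta]_x f x.
Proof.
move=> cylc fc; apply/cvgrPdist_lt => e e0.
have e40 : 0 < e / 4 by rewrite divr_gt0.
have [S SP] := cont_fun_uniform fc e40.
pose g (x : X) : R := f (restr S x).
have fg x : `|f x - g x| <= e / 4.
  by rewrite distrC ltW //; apply: SP; exact: agree_restr.
have gS : local S g by exact: local_restr.
have [fP gP] := (bm_cont fc, bm_local gS).
have [l lE _] := local_cyl_comb gS.
have gc : (fun n => \int[mu]_x g (iter n F x)) @ Flt --> \int[eta]_x g x.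
  have intE (nu : probability X R) n : \int[nu]_x g (iter n F x) =
      \sum_(p <- l) p.1 * \int[nu]_x (incyl p.2 (iter n F x))%:R.
    rewrite -(bm_Rintegral_sum nu _ _ (h := fun p x => (incyl p.2 (iter n F x))%:R)).
      by apply: eq_Rintegral => x _; rewrite lE.
    by move=> p; exact: (bm_comp (mI n) (bm_incyl _ p.2)).
  rewrite (intE eta 0) (_ : (fun _ => _) = fun n =>
      \sum_(p <- l) p.1 * \int[mu]_x (incyl p.2 (iter n F x))%:R).
    by apply: cvg_sum_seq => p _; apply: cvgMr; exact: cylc.
  by apply/funext => n; rewrite intE.
have e20 : 0 < e / 2 by rewrite divr_gt0.
move/cvgrPdist_lt : gc => /(_ _ e20); apply: filterS => n.
have h1 := bm_Rintegral_dist eta fP gP fg.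
have h2 := bm_Rintegral_dist mu (bm_comp (mI n) fP) (bm_comp (mI n) gP)
  (fun x => fg (iter n F x)).
move: h1 h2; rewrite /= !ler_distl !ltr_distl => /andP[? ?] /andP[? ?] /andP[? ?].
by apply/andP; split; lra.
Qed.

Lemma cvg_ReM (Flt : set_system nat) {FF : Filter Flt} (c z0 : C) (z : nat -> C) :
  (fun n => complex.Re (z n)) @ Flt --> complex.Re z0 ->
  (fun n => complex.Im (z n)) @ Flt --> complex.Im z0 ->
  (fun n => complex.Re (c * z n)) @ Flt --> complex.Re (c * z0).
Proof.
move=> rc ic; rewrite Re_mulc; under eq_fun do rewrite Re_mulc.
by apply: cvgB; exact: cvgMr.
Qed.

Lemma norm_lt_Re_Im (z : C) (e : R) : `|z| < Complex e 0 ->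
  `|complex.Re z| < e /\ `|complex.Im z| < e.
Proof.
rewrite normc_def ltcR => ze; split; apply: le_lt_trans ze; rewrite -sqrtr_sqr ler_wsqrtr //.
  by rewrite lerDl sqr_ge0.
by rewrite lerDr sqr_ge0.
Qed.

Hypotheses (etaH : is_haar eta) (muH : harmonically_mixing mu).

(** The choice [J = predT] gives the growth condition of [diffusive], so both parts of the theorem
    share the lemmas below. *)
Definition diffuses_along (J : pred nat) chi :=
  forall r : nat, exists N : nat, forall n, (N <= n)%N -> J n ->
    rank_gt (fun x => ch_eval chi (iter n F x)) r.

(** Diffusion is asked of nontrivial characters only: a trivial one has integral 1 under every
    probability. *)
Lemma char_cvg (J : pred nat) chi : (ch_nontrivial chi -> diffuses_along J chi) ->
  let I n := cintegral mu (fun x => ch_eval chi (iter n F x)) in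
  let I0 := cintegral eta (ch_eval chi) in
  (fun n => complex.Re (I n)) @ within [set j | J j] \oo --> complex.Re I0 /\
  (fun n => complex.Im (I n)) @ within [set j | J j] \oo --> complex.Im I0.
Proof.
move=> dif I I0; have [nt|triv] := pselect (ch_nontrivial chi); last first.
  have -> : I0 = 1 by exact: (@cintegral_trivial _ _ _ eta chi id).
  by split; under eq_fun do rewrite [I _]cintegral_trivial //; exact: cvg_cst.
have -> : I0 = 0 by exact: haar_char.
have small e : 0 < e -> \forall n \near within [set j | J j] \oo,
    `|complex.Re (I n)| < e /\ `|complex.Im (I n)| < e.
  move=> e0; have [r rP] := muH e0; have [N NP] := dif nt r.
  exists N => // n /= Nn Jn; have [psi [psiE rpsi]] := NP n Nn Jn.
  by have := rP psi rpsi; rewrite (cintegral_ext _ psiE) => /norm_lt_Re_Im.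
by split; apply/cvgrPdist_lt => e /small; apply: filterS => n [] /=; rewrite sub0r normrN.
Qed.

(** Only the finitely many characters in the expansion [l] must diffuse, so one density-one set per
    cylinder can be found by intersection. *)
Lemma cyl_cvg (J : pred nat) s (l : seq (C * character R A M)) :
  (forall x, (incyl s x)%:R = ch_comb l x) ->
  (forall i, (i < size l)%N -> let chi := (nth (0, ch_one R A M) l i).2 in
     ch_nontrivial chi -> diffuses_along J chi) ->
  (fun n => \int[mu]_x (incyl s (iter n F x))%:R) @ within [set j | J j] \oo -->
    (\int[eta]_x (incyl s x)%:R : R).
Proof.
move=> sE dif; pose p0 := (0 : C, ch_one R A M).
have intE (nu : probability X R) n : \int[nu]_x (incyl s (iter n F x))%:R =
    \sum_(0 <= i < size l) complex.Re ((nth p0 l i).1 *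
       cintegral nu (fun x => ch_eval (nth p0 l i).2 (iter n F x))) :> R.
  transitivity (\int[nu]_x complex.Re (ch_comb l (iter n F x))).
    by apply: eq_Rintegral => x _; rewrite -sE; case: incyl.
  by rewrite (Rintegral_Re_ch_comb _ _ (mI n)) (big_nth p0).
rewrite (intE eta 0); under eq_fun do rewrite intE.
apply: cvg_sum_seq => i; rewrite mem_index_iota => /andP[_ il].
have [rc ic] := char_cvg (dif i il).
exact: cvg_ReM.
Qed.

Lemma weakstar_cvg_pushF (J : pred nat) :
  (forall s, (fun n => \int[mu]_x (incyl s (iter n F x))%:R) @ within [set j | J j] \oo
     --> (\int[eta]_x (incyl s x)%:R : R)) ->
  weakstar_cvg_along J (pushF mu F) eta.
Proof.
move=> cylc f fc; have fP := bm_cont fc.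
rewrite (bm_integralE eta fP).
under eq_fun do rewrite (integral_pushF _ fP).
apply: cvg_EFin; first by near=> n.
exact: cyl_cvg_cont cylc fc.
Unshelve. all: by end_near. Qed.

Lemma weakstar_cvg_cesaro (J : pred nat) : density_one R J ->
  (forall s, (fun n => \int[mu]_x (incyl s (iter n F x))%:R) @ within [set j | J j] \oo
     --> (\int[eta]_x (incyl s x)%:R : R)) ->
  weakstar_cvg (cesaro_avg mu F) eta.
Proof.
move=> dJ cylc f fc; have fP := bm_cont fc.
have [_ [B fB]] := fP.
rewrite (bm_integralE eta fP).
under eq_fun do rewrite (integral_cesaro_avg _ fP).
apply: cvg_EFin; first by near=> n.
(* [weakstar_cvg] is a limit within [predT], which the plain limit implies. *)
apply: cvg_within_filter.
apply: (cesaro_density (B := B) _ dJ (cyl_cvg_cont cylc fc)) => n.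
rewrite -[X in `|X|]subr0 -(probability_Rintegral_cst mu 0).
apply: bm_Rintegral_dist; [exact: (bm_comp (mI n) fP)|exact: bm_cst|].
by move=> x; rewrite subr0.
Unshelve. all: by end_near. Qed.

End Convergence.

(** * A common density-one set, and the theorem *)

Lemma cvg_within_sub (R : realType) (J K : pred nat) (u : nat -> R) (a : R) N :
  (forall n, (N <= n)%N -> K n -> J n) ->
  u @ within [set j | J j] \oo --> a -> u @ within [set j | K j] \oo --> a.
Proof.
move=> KJ ua P /ua[N' _ N'P]; exists (maxn N N') => // n /=.
by rewrite geq_max => /andP[/KJ Jn N'n] /Jn; exact: N'P.
Qed.

Lemma diffusive_in_density_cyl (R : realType) (A : finZmodType) (M : countType)
    (F : cfg A M -> cfg A M) (mu eta : probability (cfg A M) R) :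
  measurable_fun setT F -> is_haar eta -> harmonically_mixing mu ->
  diffusive_in_density R F ->
  exists2 K, density_one R K & forall s,
    (fun n => \int[mu]_x (incyl s (iter n F x))%:R) @ within [set j | K j] \oo
      --> (\int[eta]_x (incyl s x)%:R : R).
Proof.
move=> mF etaH muH dif.
have charJ (chi : character R A M) : exists J, density_one R J /\
    (ch_nontrivial chi -> diffuses_along F J chi).
  have [nt|triv] := pselect (ch_nontrivial chi); last first.
    by exists predT; split; [exact: density_oneT|].
  by have [J [dJ JP]] := dif chi nt; exists J.
have cylJ s : exists J, density_one R J /\
    (fun n => \int[mu]_x (incyl s (iter n F x))%:R) @ within [set j | J j] \oo
      --> (\int[eta]_x (incyl s x)%:R : R).
  have [l lE] := trigpoly_cyl R s; have [J JP] := choice charJ.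
  pose chi i := (nth (0, ch_one R A M) l i).2.
  exists (fun n => all (fun i => J (chi i) n) (iota 0 (size l))); split.
    by apply: (@density_one_all R _ _ (fun i => J (chi i))) => i; exact: (JP _).1.
  apply: (cyl_cvg mF etaH muH lE) => i il chii nt r.
  have [N NP] := (JP chii).2 nt r; exists N => n Nn /allP Jn; apply: NP => //.
  by apply: (Jn i); rewrite mem_iota.
have [Js JsP] := choice cylJ.
(* Numbers that code no cylinder impose no condition. *)
pose J k := if unpickle k is Some s then Js s else predT.
have [|K dK KJ] := @density_one_diag R J.
  by move=> k; rewrite /J; case: unpickle => [s|]; [exact: (JsP s).1|exact: density_oneT].
exists K => // s; have [N NP] := KJ (pickle s).
by apply: cvg_within_sub (JsP s).2 => n Nn /(NP n Nn); rewrite /J pickleK.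
Qed.

Theorem mainTheorem9 (R : realType) (A : finZmodType) (M : countType)
  (mul : M -> M -> M) (one : M)
  (mulA : forall a b c, mul a (mul b c) = mul (mul a b) c)
  (mul1m : forall a, mul one a = a) (mulm1 : forall a, mul a one = a)
  (F : conf A M -> conf A M) (HF : is_LCA mul F)
  (eta : probability (cfg A M) R) (Heta : is_haar eta)
  (mu : probability (cfg A M) R) (Hmu : harmonically_mixing mu) :
  (diffusive R F -> weakstar_cvg (pushF mu F) eta) /\
  (diffusive_in_density R F ->
     (exists J : pred nat, density_one R J /\ weakstar_cvg_along J (pushF mu F) eta) /\
     weakstar_cvg (cesaro_avg mu F) eta).
Proof.
have [Fc _ _] := HF; have mF := measurable_cont_map R Fc.
split=> [dif|/(diffusive_in_density_cyl mF Heta Hmu)[K dK KP]]; last first.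
  split; last exact: weakstar_cvg_cesaro dK KP.
  by exists K; split=> //; exact: weakstar_cvg_pushF.
(* Under full diffusivity all times are admissible. *)
apply: (weakstar_cvg_pushF (J := predT) mF) => s.
have [l lE] := trigpoly_cyl R s.
apply: (cyl_cvg mF Heta Hmu lE) => i _ chi nt r.
by have [N NP] := dif chi nt r; exists N => n Nn _; exact: NP.
Qed.
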